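(* Let $u$ be as in the standing assumption of the context. Then at every point $(x,t)\in\hat\Omega$ where $u(x,t)<0$ we have \[v\,u^2\le\max_{\{(y,0)\in\hat\Omega\colon u(y,0)<0\}} v\,u^2 .\]
   Context: Standing assumption: $\hat\Omega\subset\mathbb{R}^{n+1}\times[0,\infty)$ is a (relatively) open set and $u\colon\hat\Omega\to\mathbb{R}$ is a smooth solution of $\dot u=\sqrt{1+|Du|^2}\,\mathrm{div}\!\left(\frac{Du}{\sqrt{1+|Du|^2}}\right)$ in $\hat\Omega\cap(\mathbb{R}^{n+1}\times(0,\infty))$; $u(x,t)\to0$ as $(x,t)\to(x_0,t_0)\in\partial\hat\Omega$; for every $T>0$ all derivatives of $u$ are uniformly bounded on $\hat\Omega\cap(\mathbb{R}^{n+1}\times[0,T])$ and extend continuously across the boundary, and $\hat\Omega\cap(\mathbb{R}^{n+1}\times[0,T])$ is bounded. Here $v:=\sqrt{1+|Du|^2}$ (equivalently $v=(-\langle e_{n+2},\nu\rangle)^{-1}$ for the downward unit normal $\nu$ of $\operatorname{graph}u(\cdot,t)\subset\mathbb{R}^{n+2}$). *)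

(* Defs.v *)
From HB Require Import structures.
From mathcomp Require Import all_boot all_order all_algebra.
From mathcomp Require Import all_classical all_reals all_analysis.
Set Implicit Arguments. Unset Strict Implicit. Unset Printing Implicit Defensive.
Import Order.TTheory GRing.Theory Num.Theory.
Import numFieldNormedType.Exports.
Local Open Scope classical_set_scope.
Local Open Scope ring_scope.

(* Space-time points (x, t) with x in R^{n+1} (row vectors) and t in R. *)
Definition pt (R : realType) (n : nat) := ('rV[R]_(n.+1) * R)%type.

Definition dir {R : realType} {n : nat} (d : option 'I_n.+1) : pt R n :=
  match d with
  | Some i => (delta_mx 0 i, 0)
  | None => (0, 1)
  end.

Definition Dmulti (R : realType) (n : nat) (a : seq (option 'I_n.+1))
  (u : pt R n -> R) : pt R n -> R :=
  foldr (fun d f => fun p => ('D_(dir d) f) p) u a.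

Definition du (R : realType) (n : nat) (u : pt R n -> R) (i : 'I_n.+1) :
  pt R n -> R := fun p => ('D_(dir (Some i)) u) p.
Definition dt (R : realType) (n : nat) (u : pt R n -> R) : pt R n -> R :=
  fun p => ('D_(dir None) u) p.

Definition vgrad (R : realType) (n : nat) (u : pt R n -> R) : pt R n -> R :=
  fun p => Num.sqrt (1 + \sum_(i < n.+1) (du u i p) ^+ 2).

Definition mcf_rhs (R : realType) (n : nat) (u : pt R n -> R) : pt R n -> R :=
  fun p => vgrad u p *
    \sum_(i < n.+1) ('D_(dir (Some i)) (fun q => du u i q / vgrad u q)) p.

Definition standing_assumption (R : realType) (n : nat)
  (Omega : set (pt R n)) (u : pt R n -> R) : Prop :=
  (
   (exists O : set (pt R n), open O /\ Omega = O `&` [set p | 0 <= p.2]) /\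
   (forall (a : seq (option 'I_n.+1)) (p : pt R n), Omega p -> 0 < p.2 ->
      {for p, continuous (Dmulti a u)} /\
      forall d, derivable (Dmulti a u) p (dir d)) /\
   ({within Omega, continuous u} /\
   (forall (p : pt R n) (i : 'I_n.+1), Omega p -> derivable u p (dir (Some i)))) /\
   (forall p : pt R n, Omega p -> 0 < p.2 -> dt u p = mcf_rhs u p) /\
   (forall p0 : pt R n, closure Omega p0 -> ~ Omega p0 ->
      u @ within Omega (nbhs p0) --> (0 : R)) /\
   (forall T : R, 0 < T ->
      (exists M : R, forall p : pt R n, Omega p -> p.2 <= T -> `|p.1| <= M) /\
      forall a : seq (option 'I_n.+1),
        (exists M : R, forall p : pt R n, Omega p -> 0 < p.2 -> p.2 <= T ->
            `|Dmulti a u p| <= M) /\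
        (exists g : pt R n -> R,
            {within closure [set p | Omega p /\ p.2 <= T], continuous g} /\
            forall p : pt R n, Omega p -> 0 < p.2 -> p.2 <= T ->
              g p = Dmulti a u p))).

(* Main.v *)
Require Import Defs.
From HB Require Import structures.
From mathcomp Require Import all_boot all_order all_algebra.
From mathcomp Require Import all_classical all_reals all_analysis.
From mathcomp Require Import ring lra.
Import Order.TTheory GRing.Theory Num.Theory.
Import numFieldNormedType.Exports.
Local Open Scope classical_set_scope.
Local Open Scope ring_scope.

(* Apply the maximum principle to psi = (v u^2)^2 = q u^4, where q = v^2 =
   1 + |Du|^2 is polynomial in the derivatives of u. Let psi - eps t be maximal,
   over the closure of the slab t <= T, at a point where t > 0 and u < 0. There
   D psi = 0, i.e. u D^2u Du = -2 q Du, while psi_t >= eps > 0 and D^2 psi <= 0.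
   With s = |Du|^2, differentiating q u_t = q tr(D^2u) - D^2u(Du, Du) gives
     q psi_t - (q tr(D^2 psi) - D^2 psi(Du, Du))
       = 4 q s u^2 + 8 q^2 s u^2 - 2 q u^4 |D^2u|^2,
   and |D^2u|^2 s >= |D^2u Du|^2 = 4 q^2 s / u^2 makes the right-hand side <= 0
   (as is clear if s = 0). Since q tr M - M(Du, Du) <= 0 for M <= 0, this
   contradicts psi_t > 0. Hence the maximum sits at t = 0, and eps -> 0 gives
   the claim. *)

(** * Calculus of directional derivatives: additivity in the direction, Schwarz's theorem,
    second-order conditions at a maximum *)

Section DirectionalCalculus.
Context {R : realType} {V : normedModType R}.
Implicit Types (f g : V -> R) (a v w : V) (h : R).

Lemma is_derive_scalev f a v (c d : R) :
  is_derive a v f d -> is_derive a (c *: v) f (c * d).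
Proof.
move=> [fd fE]; have [->|c0] := eqVneq c 0.
  by rewrite scale0r mul0r; exact: is_derive0.
suff H : (fun h => h^-1 *: ((f \o shift a) (h *: (c *: v)) - f a)) @ 0^'
    --> c * d.
  by split; [apply/cvg_ex; exists (c * d) | apply: cvg_lim H].
have -> : (fun h => h^-1 *: ((f \o shift a) (h *: (c *: v)) - f a)) =
  (fun h => c * ((fun k => k^-1 *: ((f \o shift a) (k *: v) - f a)) (h * c))).
  apply/funext => h /=; rewrite scalerA invfM.
  by rewrite -![_ *: _]/(_ * _) mulrA mulrCA divff // mulr1.
apply: cvgM; first exact: cvg_cst.
have H1 : h * c @[h --> 0^'] --> (0 : R)^'.
  move=> A [e /= e0 eA]; exists (e / `|c|); first by rewrite /= divr_gt0 ?normr_gt0.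
  move=> h /=; rewrite sub0r normrN ltr_pdivlMr ?normr_gt0// => he h0.
  by apply: eA; rewrite /= ?sub0r ?normrN ?normrM // mulf_neq0.
rewrite -fE; exact: (cvg_comp _ _ H1 fd).
Qed.

Lemma is_derive_line f a v h :
  derivable f (h *: v + a) v ->
  is_derive h 1 (fun k => f (k *: v + a)) ('D_v f (h *: v + a)).
Proof.
have E : (fun k : R => k^-1 *: (((fun k => f (k *: v + a)) \o shift h) (k *: 1)
     - f (h *: v + a))) =
  (fun k => k^-1 *: ((f \o shift (h *: v + a)) (k *: v) - f (h *: v + a))).
  by apply/funext => k /=; rewrite [_ *: 1]mulr1 scalerDl addrA.
by move=> fd; split; rewrite /derivable /derive E.
Qed.

(** The segment is parametrised by [s] in [0, 1] rather than by its endpoints, so [h] may have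
    either sign. *)
Lemma MVT_line f a v h :
  (forall s, 0 <= s <= 1 -> derivable f ((s * h) *: v + a) v) ->
  exists2 s, 0 < s < 1 &
    f (h *: v + a) - f a = h * 'D_v f ((s * h) *: v + a).
Proof.
move=> fd.
have gd (s : R) : 0 <= s <= 1 ->
  is_derive s 1 (fun k => f (k *: (h *: v) + a)) (h * 'D_v f ((s * h) *: v + a)).
  move=> s01; have /derivableP/(is_derive_scalev _ _ _ h) [D E] := fd s s01.
  by rewrite -E -scalerA; apply: is_derive_line; rewrite scalerA.
have [||s] := @MVT R (fun k => f (k *: (h *: v) + a))
    (fun s => h * 'D_v f ((s * h) *: v + a)) 0 1 ltr01.
- by move=> s; rewrite in_itv /= => /andP[s0 s1]; apply: gd; rewrite !ltW.
- apply: derivable_within_continuous => s; rewrite in_itv /= => s01.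
  exact: (ex_derive (is_derive := gd s s01)).
rewrite in_itv /= => s01; rewrite scale1r scale0r add0r subr0 mulr1 => E.
by exists s.
Qed.

Lemma near_plane (P : set V) a v w : nbhs a P ->
  exists2 d : R, 0 < d &
    forall s k : R, `|s| < d -> `|k| < d -> P (s *: v + (k *: w + a)).
Proof.
move=> aP.
have C : (fun z : R * R => z.1 *: v + (z.2 *: w + a)) z @[z --> (0, 0)] --> a.
  rewrite -[X in _ --> X]add0r -[X in _ --> X + _](scale0r v).
  rewrite -[X in _ --> _ + X]add0r -[X in _ --> _ + (X + _)](scale0r w).
  apply: cvgD; first by apply: cvgZr_tmp; exact: cvg_fst.
  by apply: cvgD; [apply: cvgZr_tmp; exact: cvg_snd|exact: cvg_cst].
have /nbhs_ballP[d /= d0 dP] := C _ aP.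
exists d => // s k sd kd; apply: (dP (s, k)).
by split; rewrite /= -ball_normE /= sub0r normrN.
Qed.

Lemma near_line (P : set V) a v : nbhs a P ->
  \forall h \near (0 : R), P (h *: v + a).
Proof.
move=> aP; suff C : (fun h : R => h *: v + a) h @[h --> 0] --> a by exact: C _ aP.
rewrite -[X in _ --> X]add0r -[X in _ --> X + _](scale0r v).
by apply: cvgD; [apply: cvgZr_tmp; exact: cvg_id|exact: cvg_cst].
Qed.

(** Total differentiability is not assumed, so the increment is split into a step along [v] and then
    one along [w]. The mean value theorem turns the second quotient into a value of [g] near [a],
    and continuity of [g] gives its limit. *)
Lemma is_derive_addv f g a v w (d : R) :
  is_derive a v f d -> (\forall q \near a, is_derive q w f (g q)) ->
  {for a, continuous g} ->
  is_derive a (v + w) f (d + g a).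
Proof.
move=> [fv fvE] fw cg.
suff H : (fun h => h^-1 *: ((f \o shift a) (h *: (v + w)) - f a)) @ 0^'
    --> d + g a.
  by split; [apply/cvg_ex; eexists; exact: H | apply: cvg_lim H].
have -> : (fun h => h^-1 *: ((f \o shift a) (h *: (v + w)) - f a)) =
  (fun h => h^-1 *: ((f \o shift a) (h *: v) - f a) +
     h^-1 * (f (h *: w + (h *: v + a)) - f (h *: v + a))).
  apply/funext => h /=; rewrite -mulrDr; congr (_ * _).
  by rewrite scalerDr -[_ + _ + a]addrA (addrCA (h *: v)); ring.
apply: cvgD; first by rewrite -fvE; exact: fv.
apply/cvgrPdist_le => e e0.
have /cvgrPdist_le/(_ e e0) cge := cg.
have [r r0 rP] := near_plane _ _ w v (filterI fw cge).
near=> h.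
have hr : `|h| < r by near: h; exact: dnbhs0_lt.
have h0 : h != 0 by near: h; exact: nbhs_dnbhs_neq.
have sh s : 0 <= s <= 1 -> `|s * h| < r.
  move=> /andP[s0 s1]; rewrite normrM (ger0_norm s0) (le_lt_trans _ hr)//.
  by rewrite ler_piMl.
have [s|s /andP[s0 s1] ->] := @MVT_line f (h *: v + a) w h.
  by move=> /sh H; have [[]] := rP _ _ H hr.
have [D] := rP _ _ (sh s (introT andP (conj (ltW s0) (ltW s1)))) hr.
by rewrite mulKf// (derive_val (is_derive := D)).
Unshelve. all: by end_near. Qed.

Lemma is_derive_comb f fv fw a v w (b c : R) :
  is_derive a v f fv -> (\forall q \near a, is_derive q w f (fw q)) ->
  {for a, continuous fw} ->
  is_derive a (b *: v + c *: w) f (b * fv + c * fw a).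
Proof.
move=> fd fdw cw; apply: (@is_derive_addv f (fun q => c * fw q)).
- exact: is_derive_scalev.
- by apply: filterS fdw => q; exact: is_derive_scalev.
- by apply: cvgM; [exact: cvg_cst|exact: cw].
Qed.

Lemma is_derive_translate f c a v (d : R) :
  is_derive (c + a) v f d -> is_derive a v (fun q => f (c + q)) d.
Proof.
have E : (fun h : R => h^-1 *: (((fun q => f (c + q)) \o shift a) (h *: v)
     - f (c + a))) =
  (fun h => h^-1 *: ((f \o shift (c + a)) (h *: v) - f (c + a))).
  by apply/funext => h /=; rewrite addrCA.
by move=> [fd <-]; split; rewrite /derivable /derive E.
Qed.

(** Two mean value theorems: first along [v] for the difference f(h w + q) - f(q), then along [w]
    for ['D_v f]. *)
Lemma mixed_difference f a v w (d h : R) :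
  (forall s k, `|s| < d -> `|k| < d ->
     derivable f (s *: v + (k *: w + a)) v /\
     derivable ('D_v f) (s *: v + (k *: w + a)) w) ->
  0 < h -> h < d ->
  exists s k, [/\ `|s| < d, `|k| < d &
    f (h *: w + (h *: v + a)) - f (h *: v + a) - f (h *: w + a) + f a =
    h * h * 'D_w ('D_v f) (s *: v + (k *: w + a))].
Proof.
move=> fd h0 hd.
have d0 : 0 < d by rewrite (lt_trans h0).
have sh (s : R) : 0 <= s <= 1 -> `|s * h| < d.
  move=> /andP[s0 s1]; rewrite ger0_norm ?mulr_ge0 ?(ltW h0)//.
  by rewrite (le_lt_trans _ hd)// ler_piMl// ltW.
have h1 : `|h| < d by rewrite gtr0_norm.
pose g q := f (h *: w + q) - f q.
have gd s : `|s| < d ->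
  is_derive (s *: v + a) v g
   ('D_v f (h *: w + (s *: v + a)) - 'D_v f (s *: v + a)).
  move=> sd; have [/derivableP H1 _] := fd _ _ sd h1.
  have [/derivableP H2 _] := fd _ 0 sd (etrans (congr1 (<%R^~ d) (normr0 _)) d0).
  apply: is_deriveB; first by apply: is_derive_translate; rewrite addrCA.
  by move: H2; rewrite scale0r add0r.
have [s /sh sd|s /andP[s0 s1] gE] := @MVT_line g a v h.
  exact: (ex_derive (is_derive := gd _ sd)).
have sd : `|s * h| < d by apply: sh; rewrite !ltW.
have [k /sh kd|k /andP[k0 k1] kE] :=
    @MVT_line ('D_v f) ((s * h) *: v + a) w h.
  by rewrite addrCA; have [] := fd _ _ sd kd.
exists (s * h), (k * h); split; [exact: sd|by apply: sh; rewrite !ltW|].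
have [_ DE] := gd _ sd; rewrite DE kE in gE.
rewrite (addrCA ((s * h) *: v)).
transitivity (g (h *: v + a) - g a); first by rewrite /g; ring.
by rewrite gE mulrA.
Qed.

(** Schwarz's theorem. The second difference is symmetric in [v] and [w], so each mixed derivative,
    taken at its own intermediate point, has the same value; continuity brings both points to
    [a]. *)
Lemma derive_comm f a v w :
  (\forall q \near a, [/\ derivable f q v, derivable f q w,
     derivable ('D_v f) q w & derivable ('D_w f) q v]) ->
  {for a, continuous ('D_w ('D_v f))} -> {for a, continuous ('D_v ('D_w f))} ->
  'D_w ('D_v f) a = 'D_v ('D_w f) a.
Proof.
move=> fd cvw cwv; apply/eqP; rewrite -subr_eq0 -normr_le0; apply/ler_addgt0Pl => e e0.
rewrite addr0; have e2 : 0 < e / 2 by rewrite divr_gt0.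
have /cvgrPdist_le/(_ _ e2) Hvw := cvw.
have /cvgrPdist_le/(_ _ e2) Hwv := cwv.
have [d d0 dP] := near_plane _ _ v w (filterI fd (filterI Hvw Hwv)).
have h0 : 0 < d / 2 by rewrite divr_gt0.
have hd : d / 2 < d by rewrite ltr_pdivrMr// ltr_pMr// ltr1n.
have [s [k [sd kd E1]]] : exists s k, [/\ `|s| < d, `|k| < d & _] :=
  @mixed_difference f a v w d (d / 2)
  (fun s k sd kd => let: conj (And4 a b c _) _ := dP s k sd kd in conj a c) h0 hd.
have [s' [k' [sd' kd' E2]]] : exists s k, [/\ `|s| < d, `|k| < d & _] :=
  @mixed_difference f a w v d (d / 2)
  (fun s k sd kd => ltac:(rewrite addrCA; have [[]] := dP k s kd sd; by split)) h0 hd.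
have [_ [B1 _]] := dP _ _ sd kd; have [_ [_ B2]] := dP _ _ kd' sd'.
rewrite (addrCA (s' *: w)) (addrCA ((d / 2) *: v)) in E2.
move: ('D_w ('D_v f) _) ('D_v ('D_w f) _) => X Y in E1 E2 B1 B2.
have XY : X = Y.
  have hh : d / 2 * (d / 2) != 0 by rewrite mulf_neq0 ?gt_eqF.
  apply: (mulfI hh); rewrite -E1 -E2; ring.
rewrite (le_trans (ler_distD X _ _))// (splitr e) lerD//.
by rewrite distrC XY.
Qed.

(** If the second derivative were positive then, since the first one vanishes at [a], it would be
    positive at all small positive parameters, and the mean value theorem would give a value above
    f(a). *)
Lemma derive2_at_max f a v :
  (\forall q \near a, derivable f q v) -> derivable ('D_v f) a v ->
  (\forall h \near (0 : R), f (h *: v + a) <= f a) ->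
  'D_v f a = 0 /\ 'D_v ('D_v f) a <= 0.
Proof.
move=> fd fdd fmax.
have [d d0 dP] := near_plane _ _ v 0 fd.
have {}dP s : `|s| < d -> derivable f (s *: v + a) v.
  by move=> /dP /(_ (etrans (congr1 (<%R^~ d) (normr0 _)) d0)); rewrite scaler0 add0r.
have /nbhs_ballP[d' /= d'0 d'P] := fmax.
pose m := Num.min d d'; have m0 : 0 < m by rewrite lt_min d0.
have mP s : `|s| < m -> derivable f (s *: v + a) v /\ f (s *: v + a) <= f a.
  rewrite lt_min => /andP[/dP ? sd']; split=> //; apply: d'P.
  by rewrite -ball_normE /= sub0r normrN.
have D0 : 'D_v f a = 0.
  have H : is_derive (0 : R) 1 (fun k => f (k *: v + a)) 0.
    apply: (@derive1_at_max _ _ (- m) m); first by rewrite ge0_cp// ltW.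
    - move=> t; rewrite in_itv /= -ltr_norml => /mP[H _].
      exact: (ex_derive (is_derive := is_derive_line _ _ _ _ H)).
    - by rewrite in_itv /= oppr_lt0 m0.
    - move=> t; rewrite in_itv /= -ltr_norml => /mP[_].
      by rewrite scale0r add0r.
  have := @is_derive_line f a v 0; rewrite scale0r add0r => /(_ (nbhs_singleton fd)) H'.
  by rewrite -(derive_val (is_derive := H')) (derive_val (is_derive := H)).
split => //; rewrite leNgt; apply/negP => c0.
have /cvgr_gt/(_ 0 c0) := fdd.
move=> -[r /= r0 rP].
(* Below [m] the value at [a] is maximal; below [r] the difference quotient of ['D_v f] is
   positive. *)
pose h := Num.min m r / 2.
have mr0 : 0 < Num.min m r by rewrite lt_min m0.
have h0 : 0 < h by rewrite divr_gt0.
have hmr : h < Num.min m r by rewrite ltr_pdivrMr// ltr_pMr// ltr1n.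
clearbody h.
have sh s : 0 <= s <= 1 -> `|s * h| < Num.min m r.
  move=> /andP[s0 s1]; rewrite ger0_norm ?mulr_ge0 ?(ltW h0)//.
  by rewrite (le_lt_trans _ hmr)// ler_piMl// ltW.
have [s /sh|s /andP[s0 s1] E] := @MVT_line f a v h.
  by rewrite lt_min => /andP[/mP[]].
have shmr : `|s * h| < Num.min m r by apply: sh; rewrite !ltW.
have := hmr; rewrite lt_min => /andP[hm _].
have /mP[_] : `|h| < m by rewrite gtr0_norm.
rewrite leNgt -subr_gt0 E mulr_gt0 //.
have sh0 : 0 < s * h by rewrite mulr_gt0.
have := rP (s * h); rewrite /= sub0r normrN D0 subr0 gt_eqF//.
move: shmr; rewrite lt_min => /andP[_ shr] /(_ shr isT).
by rewrite pmulr_rgt0 // invr_gt0.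
Qed.

End DirectionalCalculus.

(** * Finite-sum algebra at a maximum point *)

Section MaximumPointAlgebra.
Context {R : realFieldType} {n : nat}.
Implicit Types (P : 'I_n -> R) (H M : 'I_n -> 'I_n -> R).

(* The polarisation behind tr M |P|^2 - M(P, P) <= 0 for negative M: the left-hand
   summand is M evaluated on P_i e_j - P_j e_i. *)
Lemma sum_pair_form P M :
  \sum_i \sum_j (P i ^+ 2 * M j j - P i * P j * (M i j + M j i) + P j ^+ 2 * M i i)
  = 2 * ((\sum_i P i ^+ 2) * \sum_i M i i - \sum_i \sum_j P i * P j * M i j).
Proof.
have E1 : \sum_i \sum_j P i ^+ 2 * M j j = (\sum_i P i ^+ 2) * \sum_i M i i.
  by rewrite mulr_suml; apply: eq_bigr => i _; rewrite mulr_sumr.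
have E2 : \sum_i \sum_j P j ^+ 2 * M i i = (\sum_i P i ^+ 2) * \sum_i M i i.
  by rewrite exchange_big /= E1.
have E3 : \sum_i \sum_j P i * P j * M j i = \sum_i \sum_j P i * P j * M i j.
  by rewrite exchange_big /=; apply: eq_bigr => i _; apply: eq_bigr => j _; ring.
under eq_bigr => i _.
  under eq_bigr => j _ do rewrite mulrDr.
  rewrite big_split sumrB big_split /=.
  over.
rewrite big_split sumrB big_split /= E1 E2 E3; ring.
Qed.

(** Lagrange's identity: the gap is half the sum of the squares of f_i g_j - f_j g_i, which
    [sum_pair_form] evaluates with M i j = g_i g_j. *)
Lemma cauchy_schwarz_sum (f g : 'I_n -> R) :
  (\sum_i f i * g i) ^+ 2 <= (\sum_i f i ^+ 2) * \sum_i g i ^+ 2.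
Proof.
rewrite -subr_ge0.
have -> : (\sum_i f i ^+ 2) * (\sum_i g i ^+ 2) - (\sum_i f i * g i) ^+ 2 =
   2^-1 * \sum_i \sum_j (f i * g j - f j * g i) ^+ 2.
  have -> : \sum_i \sum_j (f i * g j - f j * g i) ^+ 2 =
     \sum_i \sum_j (f i ^+ 2 * g j ^+ 2 - f i * f j * (g i * g j + g j * g i)
                    + f j ^+ 2 * g i ^+ 2).
    by apply: eq_bigr => i _; apply: eq_bigr => j _; ring.
  rewrite (sum_pair_form f (fun i j => g i * g j)) mulKf //.
  congr (_ * _ - _).
  rewrite expr2 mulr_suml; apply: eq_bigr => i _; rewrite mulr_sumr.
  by apply: eq_bigr => j _; ring.
by rewrite mulr_ge0// sumr_ge0// => i _; rewrite sumr_ge0// => j _; rewrite sqr_ge0.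
Qed.

(** Dictionary at the maximum point: [U] = u, [Ut] = u_t, [P] = Du, [Pt] = D(u_t), [H] = D^2u, [L] =
    D^3u, [K] = D^2u Du, [M] = D^2 psi. Nonpositivity of [M] enters only through the vectors e_i and
    P_i e_j - P_j e_i. *)
Lemma no_interior_max (U Ut : R) P (Pt : 'I_n -> R) H
    (L : 'I_n -> 'I_n -> 'I_n -> R) M :
  let q := 1 + \sum_l P l ^+ 2 in
  let K i := \sum_l P l * H i l in
  U != 0 -> (forall i j, H i j = H j i) -> (forall i j l, L i j l = L l i j) ->
  q * Ut = q * (\sum_i H i i) - \sum_i P i * K i ->
  (forall l, 2 * K l * Ut + q * Pt l =
     2 * K l * (\sum_i H i i) + q * (\sum_i L l i i)
     - \sum_i \sum_j (H l i * P j * H i j + P i * H l j * H i j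
                      + P i * P j * L l i j)) ->
  (forall k, 4 * q * U ^+ 3 * P k + 2 * U ^+ 4 * K k = 0) ->
  0 < 4 * q * U ^+ 3 * Ut + 2 * U ^+ 4 * (\sum_l P l * Pt l) ->
  (forall i j, M i j = 8 * U ^+ 3 * (K i * P j + P i * K j)
     + 12 * q * U ^+ 2 * P i * P j + 4 * q * U ^+ 3 * H i j
     + 2 * U ^+ 4 * (\sum_l H j l * H i l + \sum_l P l * L i j l)) ->
  (forall i, M i i <= 0) ->
  (forall i j,
     P i ^+ 2 * M j j - P i * P j * (M i j + M j i) + P j ^+ 2 * M i i <= 0) ->
  False.
Proof.
move=> q K U0 Hsym Lsym pde dpde first_order psit ME Mdiag Mpair.
pose s := \sum_l P l ^+ 2; have qE : q = 1 + s by [].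
set Tr := \sum_i H i i in pde dpde.
set Y := \sum_l P l * Pt l in psit.
(* [kap] is D^2u(Du, Du), [N] is |D^2u Du|^2 and [E] is |D^2u|^2. Up to the factor 2 U^4, [A1] and
   [A3] are the third-derivative parts of tr M and of M(P, P). *)
pose kap := \sum_i P i * K i; rewrite -/kap in pde.
pose N := \sum_i K i ^+ 2.
pose E := \sum_i \sum_l H i l ^+ 2.
pose A1 := \sum_i \sum_l P l * L i i l.
pose A3 := \sum_i \sum_j P i * P j * (\sum_l P l * L i j l).
have s0 : 0 <= s by rewrite sumr_ge0// => i _; rewrite sqr_ge0.
have q0 : 0 < q by rewrite qE ltr_pwDl.
(* The first-order condition divided by 2 U^3. *)
have KP k : U * K k = - 2 * q * P k.
  apply: (mulfI (expf_neq0 3 U0)); apply: (mulfI (_ : 2 != 0 :> R)) => //.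
  by apply/eqP; rewrite -subr_eq0; apply/eqP; rewrite -[RHS](first_order k); ring.
have kapE : U * kap = - 2 * q * s.
  rewrite /kap /s !mulr_sumr; apply: eq_bigr => i _.
  by rewrite mulrCA KP; ring.
have NE : U ^+ 2 * N = 4 * q ^+ 2 * s.
  rewrite /N /s !mulr_sumr; apply: eq_bigr => i _.
  by rewrite -exprMn KP; ring.
have CS : N <= s * E.
  rewrite /N /E mulr_sumr; apply: ler_sum => i _.
  exact: cauchy_schwarz_sum.
have trM : \sum_i M i i = 16 * U ^+ 3 * kap + 12 * q * U ^+ 2 * s
    + 4 * q * U ^+ 3 * Tr + 2 * U ^+ 4 * E + 2 * U ^+ 4 * A1.
  rewrite /kap /s /Tr /E /A1 !mulr_sumr -!big_split /=; apply: eq_bigr => i _.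
  rewrite ME (_ : \sum_l H i l * H i l = \sum_l H i l ^+ 2) //; ring.
have pMp : \sum_i \sum_j P i * P j * M i j = 16 * U ^+ 3 * kap * s
    + 12 * q * U ^+ 2 * s ^+ 2 + 4 * q * U ^+ 3 * kap + 2 * U ^+ 4 * N
    + 2 * U ^+ 4 * A3.
  have NE' : N = \sum_i \sum_j P i * P j * (\sum_l H j l * H i l).
    rewrite /N.
    transitivity (\sum_l \sum_i \sum_j (P i * P j * (H j l * H i l))).
      apply: eq_bigr => l _; rewrite expr2 {1}/K mulr_suml; apply: eq_bigr => i _.
      by rewrite mulr_sumr; apply: eq_bigr => j _; rewrite !(Hsym l); ring.
    rewrite exchange_big; apply: eq_bigr => i _; rewrite exchange_big.
    by apply: eq_bigr => j _; rewrite mulr_sumr.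
  have kE : kap = \sum_i \sum_j P i * P j * H i j.
    by apply: eq_bigr => i _; rewrite mulr_sumr; apply: eq_bigr => j _; ring.
  have ksE : kap * s = \sum_i \sum_j P i * P j * (K i * P j).
    rewrite mulr_suml; apply: eq_bigr => i _; rewrite mulr_sumr.
    by apply: eq_bigr => j _; ring.
  have ksE' : kap * s = \sum_i \sum_j P i * P j * (P i * K j).
    rewrite ksE exchange_big; apply: eq_bigr => i _.
    by apply: eq_bigr => j _; ring.
  have ssE : s ^+ 2 = \sum_i \sum_j P i * P j * (P i * P j).
    rewrite expr2 mulr_suml; apply: eq_bigr => i _; rewrite mulr_sumr.
    by apply: eq_bigr => j _; ring.
  rewrite (_ : 16 * U ^+ 3 * kap * s =
    8 * U ^+ 3 * (kap * s) + 8 * U ^+ 3 * (kap * s)); last ring.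
  rewrite {1}ksE ksE' ssE kE NE' /A3 !mulr_sumr -!big_split; apply: eq_bigr => i _ /=.
  rewrite !mulr_sumr -!big_split; apply: eq_bigr => j _ /=.
  rewrite ME; ring.
(* The differentiated equation contracted with [P]. Here [A1] and [A3] occur in the same combination
   as in q tr M - M(P, P), so the third derivatives will cancel. *)
have YE : q * Y = q * A1 - A3 - 2 * N - 2 * kap * (Ut - Tr).
  have -> : q * Y = \sum_l P l * (q * Pt l).
    by rewrite mulr_sumr; apply: eq_bigr => l _; ring.
  have A1E : q * A1 = \sum_l P l * (q * \sum_i L l i i).
    rewrite /A1 exchange_big mulr_sumr; apply: eq_bigr => l _ /=.
    by rewrite !mulr_sumr; apply: eq_bigr => i _; rewrite Lsym; ring.
  have A3E : A3 = \sum_l P l * \sum_i \sum_j P i * P j * L l i j.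
    transitivity (\sum_i \sum_j \sum_l P l * (P i * P j * L l i j)).
      apply: eq_bigr => i _; apply: eq_bigr => j _; rewrite mulr_sumr.
      by apply: eq_bigr => l _; rewrite (Lsym i j l); ring.
    under eq_bigr do rewrite exchange_big.
    rewrite exchange_big; apply: eq_bigr => l _ /=; rewrite mulr_sumr.
    by apply: eq_bigr => i _; rewrite mulr_sumr.
  have NE1 : N = \sum_l P l * \sum_i \sum_j H l i * P j * H i j.
    transitivity (\sum_i \sum_l P l * (H l i * K i)).
      apply: eq_bigr => i _; rewrite expr2 {1}/K mulr_suml.
      by apply: eq_bigr => l _; rewrite (Hsym i l); ring.
    rewrite exchange_big; apply: eq_bigr => l _ /=; rewrite mulr_sumr.
    apply: eq_bigr => i _; congr (_ * _); rewrite /K mulr_sumr.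
    by apply: eq_bigr => j _; ring.
  have NE2 : N = \sum_l P l * \sum_i \sum_j P i * H l j * H i j.
    rewrite NE1; apply: eq_bigr => l _; congr (_ * _); rewrite exchange_big.
    by apply: eq_bigr => i _; apply: eq_bigr => j _; rewrite (Hsym i j); ring.
  have N2E : 2 * N =
      \sum_l P l * (\sum_i \sum_j H l i * P j * H i j) +
      \sum_l P l * (\sum_i \sum_j P i * H l j * H i j).
    by rewrite -NE1 -NE2; ring.
  have KE : 2 * kap * (Ut - Tr) = \sum_l P l * (2 * K l * (Ut - Tr)).
    by rewrite /kap mulr_sumr mulr_suml; apply: eq_bigr => l _; ring.
  rewrite N2E KE A1E A3E -big_split -!sumrB; apply: eq_bigr => l _ /=.
  have -> : q * Pt l = 2 * K l * Tr + q * (\sum_i L l i i)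
     - \sum_i \sum_j (H l i * P j * H i j + P i * H l j * H i j
                      + P i * P j * L l i j) - 2 * K l * Ut.
    by rewrite -dpde; ring.
  have -> : \sum_i \sum_j (H l i * P j * H i j + P i * H l j * H i j
                      + P i * P j * L l i j) =
      \sum_i \sum_j H l i * P j * H i j + \sum_i \sum_j P i * H l j * H i j
      + \sum_i \sum_j P i * P j * L l i j.
    by rewrite -!big_split; apply: eq_bigr => i _; rewrite -!big_split.
  ring.
have trM0 : \sum_i M i i <= 0 by rewrite sumr_le0.
have pair0 : s * (\sum_i M i i) - \sum_i \sum_j P i * P j * M i j <= 0.
  rewrite -(pmulr_rle0 _ (_ : 0 < 2)) // -sum_pair_form.
  by rewrite sumr_le0// => i _; rewrite sumr_le0// => j _.
(* Since q = 1 + s, the elliptic operator is tr M plus the form bounded in [pair0]. *)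
have C0 : q * (\sum_i M i i) - \sum_i \sum_j P i * P j * M i j <= 0.
  by have := lerD trM0 pair0; rewrite addr0 qE mulrDl mul1r -addrA.
have : 0 < q * (4 * q * U ^+ 3 * Ut + 2 * U ^+ 4 * Y) -
   (q * (\sum_i M i i) - \sum_i \sum_j P i * P j * M i j).
  by rewrite subr_gt0 (le_lt_trans C0)// mulr_gt0.
have -> : q * (4 * q * U ^+ 3 * Ut + 2 * U ^+ 4 * Y) -
   (q * (\sum_i M i i) - \sum_i \sum_j P i * P j * M i j) =
   4 * q * s * U ^+ 2 + 8 * q ^+ 2 * s * U ^+ 2 - 2 * q * U ^+ 4 * E.
  have sE : s = q - 1 by rewrite qE addrAC subrr add0r.
  have UtE : q * (Ut - Tr) = - kap by rewrite mulrBr pde; ring.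
  rewrite trM pMp.
  (* [Y] and [Ut - Tr] are known only after multiplication by [q], hence this extra factor. *)
  apply: (mulfI (lt0r_neq0 q0)).
  transitivity (2 * U ^+ 4 * q * (q * Y) + 4 * q ^+ 2 * U ^+ 3 * (q * (Ut - Tr))
    - q * (16 * U ^+ 3 * kap * (q - s) + 12 * q * U ^+ 2 * s * (q - s)
           - 4 * q * U ^+ 3 * kap + 2 * U ^+ 4 * (q * (E + A1) - N - A3))).
    by ring.
  rewrite YE UtE.
  transitivity (- 4 * U ^+ 2 * (U * kap) * (U * (q * (Ut - Tr)))
    - 2 * U ^+ 2 * q * (U ^+ 2 * N)
    - q * (16 * U ^+ 2 * (U * kap) * (q - s) + 12 * q * U ^+ 2 * s * (q - s)
           + 2 * U ^+ 4 * q * E)).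
    by ring.
  rewrite UtE mulrN kapE NE sE; ring.
apply/negP; rewrite -leNgt.
have U2 : 0 < U ^+ 2 by rewrite exprn_even_gt0.
(* Cauchy-Schwarz bounds [E] from below only after division by [s]; for s = 0 only the term with [E]
   survives, and its sign is right. *)
have [s_eq0|sn0] := eqVneq s 0.
  rewrite s_eq0; rewrite !(mulr0, mul0r) !add0r oppr_le0.
  have E0 : 0 <= E.
    by apply: sumr_ge0 => i _; apply: sumr_ge0 => j _; rewrite sqr_ge0.
  have U4 : 0 <= U ^+ 4 by rewrite exprn_even_ge0.
  exact: (mulr_ge0 (mulr_ge0 (mulr_ge0 (ler0n _ 2) (ltW q0)) U4) E0).
have s_gt0 : 0 < s by rewrite lt0r sn0.
(* Insert U^2 N = 4 q^2 s into N <= s E and divide by s. *)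
have EU : 4 * q ^+ 2 <= U ^+ 2 * E.
  rewrite -(ler_pM2r s_gt0) -NE -[leRHS]mulrA ler_pM2l// [leRHS]mulrC; exact: CS.
have -> : 4 * q * s * U ^+ 2 + 8 * q ^+ 2 * s * U ^+ 2 - 2 * q * U ^+ 4 * E =
  2 * q * U ^+ 2 * (4 * q ^+ 2 - U ^+ 2 * E) - 4 * q * U ^+ 2 * (q + 1).
  by rewrite qE; ring.
have qU0 : 0 <= q * U ^+ 2 := mulr_ge0 (ltW q0) (ltW U2).
rewrite subr_le0 (@le_trans _ _ 0)//.
  rewrite mulr_ge0_le0 ?subr_le0// -mulrA; exact: mulr_ge0.
rewrite -(mulrA 4) mulr_ge0 ?addr_ge0 ?(ltW q0)//; exact: mulr_ge0.
Qed.

End MaximumPointAlgebra.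

(** * Differentiation rules for explicit pointwise expressions *)

Section PointwiseRules.
Context {R : realType} {V : normedModType R}.
Implicit Types (f g S : V -> R) (p v : V).

(** This rule and the similar ones below restate the library rules for functions written pointwise
    with real multiplication, so that they chain on explicit formulas. *)
Lemma is_derive_const (c : R) p v : is_derive p v (fun=> c) 0.
Proof. exact: is_derive_cst. Qed.

Lemma is_derive_mul {f g p v} {df dg : R} :
  is_derive p v f df -> is_derive p v g dg ->
  is_derive p v (fun q => f q * g q) (f p * dg + g p * df).
Proof. exact: is_deriveM. Qed.

Lemma is_derive_add {f g p v} {df dg : R} :
  is_derive p v f df -> is_derive p v g dg ->
  is_derive p v (fun q => f q + g q) (df + dg).
Proof. exact: is_deriveD. Qed.

Lemma is_derive_pow {f} k {p v} {df : R} :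
  is_derive p v f df ->
  is_derive p v (fun q => f q ^+ k) (k%:R * f p ^+ k.-1 * df).
Proof.
have -> : (fun q => f q ^+ k) = f ^+ k by apply/funext => q; rewrite exprfctE.
exact: is_deriveX.
Qed.

Lemma is_derive_bigsum n (h : 'I_n -> V -> R) p v (dh : 'I_n -> R) :
  (forall i, is_derive p v (h i) (dh i)) ->
  is_derive p v (fun q => \sum_(i < n) h i q) (\sum_(i < n) dh i).
Proof.
move=> hd; have -> : (fun q => \sum_(i < n) h i q) = \sum_(i < n) h i.
  by apply/funext => q; rewrite fct_sumE.
exact: is_derive_sum.
Qed.

Lemma is_derive_mul_pow4 {S f} {p v : V} {dS df : R} :
  is_derive p v S dS -> is_derive p v f df ->
  is_derive p v (fun q => S q * f q ^+ 4)
    (4 * S p * f p ^+ 3 * df + f p ^+ 4 * dS).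
Proof.
move=> Sd fd; apply: (is_derive_eq (is_derive_mul Sd (is_derive_pow 4 fd))).
by rewrite /=; ring.
Qed.

(** Second differentiation of psi = S f^4, with S = 1 + |P|^2, f = u, g = D_j u, P = Du and H l =
    D_j D_l u. The derivative of [S] is written 2 dS because dS is then the sum of the P_l dP_l. *)
Lemma is_derive_dmul_pow4 {n S f g} {P H : 'I_n -> V -> R} {p v : V}
    {dS df dg : R} {dP dH : 'I_n -> R} :
  is_derive p v S (2 * dS) -> is_derive p v f df -> is_derive p v g dg ->
  (forall l, is_derive p v (P l) (dP l)) ->
  (forall l, is_derive p v (H l) (dH l)) ->
  is_derive p v
    (fun q => 4 * S q * f q ^+ 3 * g q + 2 * f q ^+ 4 * \sum_l P l q * H l q)
    (8 * f p ^+ 3 * (dS * g p + df * \sum_l P l p * H l p)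
     + 12 * S p * f p ^+ 2 * df * g p + 4 * S p * f p ^+ 3 * dg
     + 2 * f p ^+ 4 * (\sum_l H l p * dP l + \sum_l P l p * dH l)).
Proof.
move=> Sd fd gd Pd Hd.
have d4S : is_derive p v (fun q => 4 * S q) (4 * (2 * dS)).
  apply: (is_derive_eq (is_derive_mul (is_derive_const 4 p v) Sd)).
  by rewrite mulr0 addr0.
have d2f : is_derive p v (fun q => 2 * f q ^+ 4) (2 * (4 * f p ^+ 3 * df)).
  apply: (is_derive_eq (is_derive_mul (is_derive_const 2 p v) (is_derive_pow 4 fd))).
  by rewrite mulr0 addr0.
have dPH := is_derive_bigsum _ _ _ _ _ (fun l => is_derive_mul (Pd l) (Hd l)).
apply: (is_derive_eq (is_derive_add
  (is_derive_mul (is_derive_mul d4S (is_derive_pow 3 fd)) gd)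
  (is_derive_mul d2f dPH))).
by rewrite big_split /=; ring.
Qed.

Lemma is_derive_sub {f g p v} {df dg : R} :
  is_derive p v f df -> is_derive p v g dg ->
  is_derive p v (fun q => f q - g q) (df - dg).
Proof. exact: is_deriveB. Qed.

Lemma is_derive_lincomb {f g p v} {df dg : R} (b c : R) :
  is_derive p v f df -> is_derive p v g dg ->
  is_derive p v (fun q => b * f q + c * g q) (b * df + c * dg).
Proof.
move=> fd gd; apply: (is_derive_eq (is_derive_add
  (is_derive_mul (is_derive_const b p v) fd)
  (is_derive_mul (is_derive_const c p v) gd))).
by rewrite !mulr0 !addr0.
Qed.

(** Meant for the right-hand side q tr(D^2u) - D^2u(Du, Du) of the flow, with [T] the diagonal
    second derivatives. *)
Lemma is_derive_nondivergence {n S} {P T : 'I_n -> V -> R}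
    {H : 'I_n -> 'I_n -> V -> R} {p v : V} {dS : R} {dP dT : 'I_n -> R}
    {dH : 'I_n -> 'I_n -> R} :
  is_derive p v S dS ->
  (forall i, is_derive p v (P i) (dP i)) ->
  (forall i, is_derive p v (T i) (dT i)) ->
  (forall i j, is_derive p v (H i j) (dH i j)) ->
  is_derive p v
    (fun q => S q * (\sum_i T i q) - \sum_i P i q * \sum_j P j q * H i j q)
    (dS * (\sum_i T i p) + S p * (\sum_i dT i)
     - \sum_i \sum_j (dP i * P j p * H i j p + P i p * dP j * H i j p
                        + P i p * P j p * dH i j)).
Proof.
move=> Sd Pd Td Hd.
have PHd i := is_derive_bigsum _ _ _ _ _ (fun j => is_derive_mul (Pd j) (Hd i j)).
have Td' := is_derive_bigsum _ _ _ _ _ Td.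
have PPHd := is_derive_bigsum _ _ _ _ _ (fun i => is_derive_mul (Pd i) (PHd i)).
apply: (is_derive_eq (is_derive_sub (is_derive_mul Sd Td') PPHd)).
congr (_ - _); first by ring.
apply: eq_bigr => i _; rewrite mulr_sumr mulr_suml -big_split /=.
by apply: eq_bigr => j _; ring.
Qed.

(** Restriction to a line makes the one-variable chain rule available for [is_derive_outer]. *)
Lemma is_derive_line0 f p v (d : R) :
  is_derive (0 : R) 1 (fun k => f (k *: v + p)) d <-> is_derive p v f d.
Proof.
have E : (fun k : R => k^-1 *: (((fun k => f (k *: v + p)) \o shift 0) (k *: 1)
     - f (0 *: v + p))) =
  (fun k => k^-1 *: ((f \o shift p) (k *: v) - f p)).
  by apply/funext => k /=; rewrite [_ *: 1]mulr1 scale0r add0r addr0.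
by split=> -[fd <-]; split; move: fd; rewrite /derivable /derive E.
Qed.

Lemma is_derive_outer f (g : R -> R) p v (df dg : R) :
  is_derive p v f df -> is_derive (f p) 1 g dg ->
  is_derive p v (fun q => g (f q)) (dg * df).
Proof.
move=> /is_derive_line0 fd gd; apply/is_derive_line0.
apply: (@is_derive1_comp _ g (fun k => f (k *: v + p))) => //.
by rewrite scale0r add0r.
Qed.

Lemma continuous_bigsum n (h : 'I_n -> V -> R) p :
  (forall i, {for p, continuous (h i)}) ->
  {for p, continuous (fun q => \sum_(i < n) h i q)}.
Proof. by move=> hc; apply: cvg_big => [|i _]; [exact: add_continuous|exact: hc]. Qed.

End PointwiseRules.

(** * The flow equation and the function psi on an open set where u is smooth *)

Section GraphicalFlow.
Context {R : realType} {n : nat} (u : pt R n -> R) (G : set (pt R n)).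
Hypothesis openG : open G.
Hypothesis smooth : forall a p, G p ->
  {for p, continuous (Dmulti a u)} /\ forall d, derivable (Dmulti a u) p (dir d).
Implicit Types (p z : pt R n) (d : option 'I_n.+1) (i j l : 'I_n.+1).

Local Notation D a := (Dmulti a u).

Let nearG p : G p -> \forall q \near p, G q.
Proof. by move=> Gp; exact: open_nbhs_nbhs. Qed.

Lemma Dmulti_is_derive a d p : G p -> is_derive p (dir d) (D a) (D (d :: a) p).
Proof. by move=> Gp; exact: derivableP ((smooth a p Gp).2 d). Qed.

Lemma Dmulti_continuous a p : G p -> {for p, continuous (D a)}.
Proof. by move=> Gp; exact: (smooth a p Gp).1. Qed.

Lemma Dmulti_swap a d d' p : G p -> D (d :: d' :: a) p = D (d' :: d :: a) p.
Proof.
move=> Gp; apply: (@derive_comm _ _ (D a) p (dir d') (dir d)).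
- near=> q; have Gq : G q by near: q; exact: nearG.
  have sm b := (smooth b q Gq).2.
  exact: (And4 (sm a d') (sm a d) (sm (d' :: a) d) (sm (d :: a) d')).
- exact: (Dmulti_continuous (d :: d' :: a)).
- exact: (Dmulti_continuous (d' :: d :: a)).
Unshelve. all: by end_near. Qed.

Lemma derive_eq_on (f g : pt R n -> R) d p : G p -> (forall q, G q -> f q = g q) ->
  'D_(dir d) f p = 'D_(dir d) g p.
Proof.
by move=> Gp fg; apply: near_eq_derive; apply: filterS (nearG _ Gp).
Qed.

(** One swap of the two outer derivatives, then one of the two inner ones, which may be made under
    the outer derivative because it holds on all of the open set [G]. *)
Lemma Dmulti_rot i j l p : G p ->
  D [:: Some i; Some j; Some l] p = D [:: Some l; Some i; Some j] p.
Proof.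
move=> Gp; rewrite (@Dmulti_swap [:: Some j] (Some l) (Some i) p Gp).
apply: (derive_eq_on (D [:: Some j; Some l]) (D [:: Some l; Some j]) _ _ Gp).
by move=> q Gq; exact: (@Dmulti_swap [::]).
Qed.

Lemma u_is_derive d p : G p -> is_derive p (dir d) u (D [:: d] p).
Proof. exact: (Dmulti_is_derive [::]). Qed.

Definition grad_sq p : R := 1 + \sum_(l < n.+1) D [:: Some l] p ^+ 2.

Lemma grad_sq_gt0 p : 0 < grad_sq p.
Proof. by rewrite ltr_pwDl// sumr_ge0// => l _; rewrite sqr_ge0. Qed.

Lemma duE i : du u i = D [:: Some i].
Proof. by []. Qed.

Lemma vgradE : vgrad u = fun p => Num.sqrt (grad_sq p).
Proof. by []. Qed.

(* Otherwise unification compares iterated derivatives by unfolding them. *)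
Local Opaque Dmulti.

Lemma vgrad_sq p : vgrad u p ^+ 2 = grad_sq p.
Proof. by rewrite vgradE sqr_sqrtr// ltW// grad_sq_gt0. Qed.

Lemma vgrad_gt0 p : 0 < vgrad u p.
Proof. by rewrite vgradE sqrtr_gt0 grad_sq_gt0. Qed.

Lemma is_derive_grad_sq d p : G p ->
  is_derive p (dir d) grad_sq
    (2 * \sum_(l < n.+1) D [:: Some l] p * D [:: d; Some l] p).
Proof.
move=> Gp; apply: is_derive_eq.
  apply: is_derive_add. 
  by apply: is_derive_bigsum => l; apply: is_derive_pow; exact: Dmulti_is_derive.
by rewrite add0r mulr_sumr; apply: eq_bigr => l _ /=; ring.
Qed.

(** By the quotient rule v D_i(D_i u / v) = D_ii u - D_i u (D^2u Du)_i / v^2. Multiplying by v^2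
    leaves an expression polynomial in the derivatives of u. *)
Lemma mcf_rhs_nondivergence p : G p ->
  grad_sq p * mcf_rhs u p =
  grad_sq p * (\sum_(i < n.+1) D [:: Some i; Some i] p) -
  \sum_(i < n.+1) D [:: Some i] p *
     \sum_(j < n.+1) D [:: Some j] p * D [:: Some i; Some j] p.
Proof.
move=> Gp; have v0 := vgrad_gt0 p; have vn0 := lt0r_neq0 v0.
have dv i : is_derive p (dir (Some i)) (vgrad u)
   ((\sum_(l < n.+1) D [:: Some l] p * D [:: Some i; Some l] p) / vgrad u p).
  rewrite vgradE; apply: is_derive_eq.
    apply: (@is_derive_outer _ _ grad_sq Num.sqrt).
      exact: is_derive_grad_sq.
    exact: is_derive1_sqrt (grad_sq_gt0 p).
  by move: vn0; rewrite vgradE => vn0; field.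
have dq i : 'D_(dir (Some i)) (fun q => du u i q / vgrad u q) p =
   D [:: Some i; Some i] p / vgrad u p - D [:: Some i] p *
     (\sum_(l < n.+1) D [:: Some l] p * D [:: Some i; Some l] p) / vgrad u p ^+ 3.
  rewrite duE.
  have dvi : is_derive p (dir (Some i)) (fun q => (vgrad u q)^-1)
    (- (vgrad u p) ^- 2 * ((\sum_(l < n.+1) D [:: Some l] p * D [:: Some i; Some l] p)
        / vgrad u p)).
    have [H1 H2] := dv i; split; first exact: derivableV.
    by rewrite deriveV// H2.
  apply: derive_val; apply: is_derive_eq.
    exact: is_derive_mul (Dmulti_is_derive [:: Some i] _ _ Gp) dvi.
  by rewrite /=; field.
rewrite /mcf_rhs; under eq_bigr do rewrite dq.
rewrite -vgrad_sq !mulr_sumr -sumrB; apply: eq_bigr => i _.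
by field.
Qed.

(** The function psi of the maximum principle, that is (v u^2)^2. *)
Definition lyap p : R := grad_sq p * u p ^+ 4.

Definition dlyap d p : R :=
  4 * grad_sq p * u p ^+ 3 * D [:: d] p +
  2 * u p ^+ 4 * \sum_(l < n.+1) D [:: Some l] p * D [:: d; Some l] p.

(** The derivative along e_i of [dlyap (Some j)], written out in the shape that [no_interior_max]
    expects of [M]. *)
Definition ddlyap i j p : R :=
  8 * u p ^+ 3 *
    ((\sum_(l < n.+1) D [:: Some l] p * D [:: Some i; Some l] p) * D [:: Some j] p
   + D [:: Some i] p * (\sum_(l < n.+1) D [:: Some l] p * D [:: Some j; Some l] p))
  + 12 * grad_sq p * u p ^+ 2 * D [:: Some i] p * D [:: Some j] p
  + 4 * grad_sq p * u p ^+ 3 * D [:: Some i; Some j] p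
  + 2 * u p ^+ 4 *
    (\sum_(l < n.+1) D [:: Some j; Some l] p * D [:: Some i; Some l] p
     + \sum_(l < n.+1) D [:: Some l] p * D [:: Some i; Some j; Some l] p).

Lemma is_derive_lyap d p : G p -> is_derive p (dir d) lyap (dlyap d p).
Proof.
move=> Gp; apply: (is_derive_eq
  (is_derive_mul_pow4 (is_derive_grad_sq d p Gp) (u_is_derive d p Gp))).
by rewrite mulrA (mulrC _ 2).
Qed.

Lemma is_derive_dlyap i j p : G p ->
  is_derive p (dir (Some i)) (dlyap (Some j)) (ddlyap i j p).
Proof.
move=> Gp; have D' a := Dmulti_is_derive a (Some i) p Gp.
exact: (is_derive_dmul_pow4 (is_derive_grad_sq (Some i) p Gp)
  (u_is_derive (Some i) p Gp) (D' [:: Some j]) (fun l => D' [:: Some l])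
  (fun l => D' [:: Some j; Some l])).
Qed.

Let cstc (c : R) p : {for p, continuous (fun=> c : R)}.
Proof. exact: cst_continuous. Qed.

Let cmul (f g : pt R n -> R) p : {for p, continuous f} -> {for p, continuous g} ->
  {for p, continuous (fun q => f q * g q)}.
Proof. by move=> cf cg; exact: cvgM. Qed.

Let cadd (f g : pt R n -> R) p : {for p, continuous f} -> {for p, continuous g} ->
  {for p, continuous (fun q => f q + g q)}.
Proof. by move=> cf cg; exact: cvgD. Qed.

Let cpow (f : pt R n -> R) k p : {for p, continuous f} ->
  {for p, continuous (fun q => f q ^+ k)}.
Proof.
move=> cf; elim: k => [|k IH]; first exact: cstc.
have -> : (fun q => f q ^+ k.+1) = (fun q => f q * f q ^+ k).
  by apply/funext => q; rewrite exprS.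
exact: cmul.
Qed.

Lemma grad_sq_continuous p : G p -> {for p, continuous grad_sq}.
Proof.
move=> Gp; apply: cadd; first exact: cstc.
by apply: continuous_bigsum => l; apply: cpow; exact: Dmulti_continuous.
Qed.

Lemma dlyap_continuous d p : G p -> {for p, continuous (dlyap d)}.
Proof.
move=> Gp; have cu : {for p, continuous u} := Dmulti_continuous [::] p Gp.
have cD a := Dmulti_continuous a p Gp.
have cg := grad_sq_continuous p Gp.
apply: cadd; apply: cmul => //.
- by apply: cmul; [apply: cmul => //; exact: cstc|exact: cpow].
- by apply: cmul; [exact: cstc|exact: cpow].
- by apply: continuous_bigsum => l; exact: cmul.
Qed.

Lemma ddlyap_continuous i j p : G p -> {for p, continuous (ddlyap i j)}.
Proof.
move=> Gp; have cu : {for p, continuous u} := Dmulti_continuous [::] p Gp.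
have cD a := Dmulti_continuous a p Gp.
have cg := grad_sq_continuous p Gp.
have cK k : {for p, continuous (fun q =>
    \sum_(l < n.+1) D [:: Some l] q * D [:: Some k; Some l] q)}.
  by apply: continuous_bigsum => l; exact: cmul.
have c3 : {for p, continuous (fun q => 4 * grad_sq q * u q ^+ 3)}.
  by apply: cmul; [apply: cmul => //; exact: cstc|exact: cpow].
apply: cadd; [apply: cadd; [apply: cadd|]|].
- apply: cmul; first by apply: cmul; [exact: cstc|exact: cpow].
  by apply: cadd; exact: cmul.
- apply: cmul => //; apply: cmul => //; apply: cmul; last exact: cpow.
  by apply: cmul => //; exact: cstc.
- exact: cmul.
- apply: cmul; first by apply: cmul; [exact: cstc|exact: cpow].
  by apply: cadd; apply: continuous_bigsum => l; exact: cmul.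
Qed.

Local Opaque grad_sq lyap dlyap ddlyap.

(** First and second derivatives along the spatial vector b e_j + c e_i. The mixed part keeps both
    orders of differentiation, as in [sum_pair_form]. *)
Lemma lyap_second_variation z i j (b c : R) : G z ->
  (forall w : pt R n, w.2 = 0 ->
     \forall h \near (0 : R), lyap (h *: w + z) <= lyap z) ->
  b * dlyap (Some j) z + c * dlyap (Some i) z = 0 /\
  b ^+ 2 * ddlyap j j z + b * c * (ddlyap i j z + ddlyap j i z)
  + c ^+ 2 * ddlyap i i z <= 0.
Proof.
move=> Gz zmax.
pose w : pt R n := b *: dir (Some j) + c *: dir (Some i).
have w2 : w.2 = 0 by rewrite /w /= !scaler0 addr0.
have lyapd q : G q ->
    is_derive q w lyap (b * dlyap (Some j) q + c * dlyap (Some i) q).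
  move=> Gq; apply: is_derive_comb; last exact: dlyap_continuous.
    exact: is_derive_lyap.
  by apply: filterS (nearG _ Gq) => r; exact: is_derive_lyap.
have dlyapd k : is_derive z w (dlyap (Some k))
    (b * ddlyap j k z + c * ddlyap i k z).
  apply: is_derive_comb; last exact: ddlyap_continuous.
    exact: is_derive_dlyap.
  by apply: filterS (nearG _ Gz) => r; exact: is_derive_dlyap.
have D2 : is_derive z w (fun q => b * dlyap (Some j) q + c * dlyap (Some i) q)
   (b * (b * ddlyap j j z + c * ddlyap i j z)
    + c * (b * ddlyap j i z + c * ddlyap i i z)).
  exact: is_derive_lincomb (dlyapd j) (dlyapd i).
have ddlyapd : is_derive z w ('D_w lyap)
   (b * (b * ddlyap j j z + c * ddlyap i j z)
    + c * (b * ddlyap j i z + c * ddlyap i i z)).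
  apply: near_eq_is_derive D2; apply: filterS (nearG _ Gz) => q Gq.
  by rewrite (derive_val (is_derive := lyapd q Gq)).
have [|||E1 E2] := @derive2_at_max _ _ lyap z w.
- by apply: filterS (nearG _ Gz) => q Gq; exact: (ex_derive (is_derive := lyapd q Gq)).
- exact: (ex_derive (is_derive := ddlyapd)).
- exact: zmax.
have [_ LE] := lyapd z Gz; have [_ LLE] := ddlyapd.
rewrite LE in E1; rewrite LLE in E2; split; first exact: E1.
move: (ddlyap j j z) (ddlyap i j z) (ddlyap j i z) (ddlyap i i z) E2.
by move=> jj ij ji ii; congr (_ <= _); ring.
Qed.

Local Transparent grad_sq lyap dlyap ddlyap.

Hypothesis flow : forall p, G p -> dt u p = mcf_rhs u p.

Lemma flow_nondivergence p : G p ->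
  grad_sq p * D [:: None] p =
  grad_sq p * (\sum_(i < n.+1) D [:: Some i; Some i] p) -
  \sum_(i < n.+1) D [:: Some i] p *
     \sum_(j < n.+1) D [:: Some j] p * D [:: Some i; Some j] p.
Proof. by move=> Gp; rewrite -mcf_rhs_nondivergence // -flow. Qed.

(** The nondivergence equation holds on the open set [G], so it can be differentiated along e_l; D_l
    u_t is then rewritten as the time derivative of D_l u. *)
Lemma flow_gradient l p : G p ->
  2 * (\sum_(k < n.+1) D [:: Some k] p * D [:: Some l; Some k] p) * D [:: None] p
  + grad_sq p * D [:: None; Some l] p =
  2 * (\sum_(k < n.+1) D [:: Some k] p * D [:: Some l; Some k] p)
    * (\sum_(i < n.+1) D [:: Some i; Some i] p)
  + grad_sq p * (\sum_(i < n.+1) D [:: Some l; Some i; Some i] p)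
  - \sum_(i < n.+1) \sum_(j < n.+1)
      (D [:: Some l; Some i] p * D [:: Some j] p * D [:: Some i; Some j] p
       + D [:: Some i] p * D [:: Some l; Some j] p * D [:: Some i; Some j] p
       + D [:: Some i] p * D [:: Some j] p * D [:: Some l; Some i; Some j] p).
Proof.
move=> Gp; have D' a := Dmulti_is_derive a (Some l) p Gp.
have E := derive_eq_on _ _ (Some l) p Gp flow_nondivergence.
have gd := is_derive_grad_sq (Some l) p Gp.
have rhsd := is_derive_nondivergence gd (fun i => D' [:: Some i])
  (fun i => D' [:: Some i; Some i]) (fun i j => D' [:: Some i; Some j]).
have [_ E1] := rhsd; have [_ E2] := is_derive_mul gd (D' [:: None]).
rewrite -E1 -E E2 (Dmulti_swap [::] (Some l) None p Gp).
by rewrite [RHS]addrC; congr (_ + _); rewrite mulrC.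
Qed.

Lemma lyap_no_interior_max z : G z -> u z != 0 ->
  (forall w : pt R n, w.2 = 0 ->
     \forall h \near (0 : R), lyap (h *: w + z) <= lyap z) ->
  ~ 0 < dlyap None z.
Proof.
move=> Gz u0 zmax zt.
have var i j b c := lyap_second_variation z i j b c Gz zmax.
apply: (@no_interior_max R n.+1 (u z) (D [:: None] z)
  (fun l => D [:: Some l] z) (fun l => D [:: None; Some l] z)
  (fun i j => D [:: Some i; Some j] z)
  (fun i j l => D [:: Some i; Some j; Some l] z)
  (fun i j => ddlyap i j z)).
- exact: u0.
- by move=> i j; exact: (Dmulti_swap [::]).
- by move=> i j l; exact: Dmulti_rot.
- exact: flow_nondivergence.
- by move=> l; exact: flow_gradient.
- by move=> k; have [] := var k k 1 0; rewrite mul1r mul0r addr0.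
- exact: zt.
- by [].
- move=> i; have [_] := var i i 1 0.
  by rewrite expr1n !mul1r !mul0r expr0n /= mul0r !addr0.
(* These coefficients give the direction P_i e_j - P_j e_i with P = Du. *)
- move=> i j; have [_] := var i j (D [:: Some i] z) (- D [:: Some j] z).
  by rewrite mulrN sqrrN mulNr.
Qed.

End GraphicalFlow.

(** * The closed slab t <= T: compactness and continuous extensions up to its boundary and to t =
    0 *)

Section SpaceTimeDomain.
Context {R : realType} {n : nat}.
Variables (Omega : set (pt R n)) (T : R).
Hypothesis T0 : 0 < T.
Hypothesis Omega_open :
  exists O : set (pt R n), open O /\ Omega = O `&` [set p | 0 <= p.2].
Implicit Types (p q z : pt R n) (u g : pt R n -> R).

Let W := [set p | Omega p /\ p.2 <= T].
Let K := closure W.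

Lemma near_domain p : Omega p -> \forall q \near p, 0 <= q.2 -> Omega q.
Proof.
have [G [oG ->]] := Omega_open; move=> [Op _].
by apply: filterS (open_nbhs_nbhs (conj oG Op)) => q Oq q0; split.
Qed.

Lemma domain_ge0 p : Omega p -> 0 <= p.2.
Proof. by have [G [_ ->]] := Omega_open; case. Qed.

Lemma shift_time_cvg p : k *: dir None + p @[k --> (0 : R)^'+] --> p.
Proof.
apply: cvg_at_right_filter.
suff : (fun k : R => k *: dir None + p) k @[k --> 0] --> 0 *: dir None + p.
  by rewrite scale0r add0r.
by apply: cvgD; [apply: cvgZr_tmp; exact: cvg_id|exact: cvg_cst].
Qed.

Lemma shift_time_in p : Omega p -> p.2 = 0 ->
  \forall k \near (0 : R)^'+, [/\ Omega (k *: dir None + p),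
    0 < (k *: dir None + p).2 & (k *: dir None + p).2 <= T].
Proof.
move=> Op p0; have dE (k : R) : (k *: dir None + p).2 = k.
  by rewrite /= p0 addr0 -[_ *: _]/(_ * _) mulr1.
near=> k; split.
- have H : 0 <= (k *: dir None + p).2 -> Omega (k *: dir None + p).
    by near: k; exact: (shift_time_cvg p _ (near_domain p Op)).
  by apply: H; rewrite dE.
- by rewrite dE.
- by rewrite dE ltW.
Unshelve. all: by end_near. Qed.

(** Lets limits within [Omega] and within [K] at an initial point be computed along the same
    vertical path, on which t > 0. *)
Lemma shift_time_cvg_in p (A : set (pt R n)) : Omega p -> p.2 = 0 -> W `<=` A ->
  k *: dir None + p @[k --> (0 : R)^'+] --> within A (nbhs p).
Proof.
move=> Op p0 WA B AB.
have H : \forall k \near (0 : R)^'+,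
    A (k *: dir None + p) -> B (k *: dir None + p) := shift_time_cvg p _ AB.
change (\forall k \near (0 : R)^'+, B (k *: dir None + p)).
by apply: filterS2 H (shift_time_in p Op p0) => k HB [Ok _ kT]; apply/HB/WA.
Qed.

(** At t = 0 both [g] and [u] are limits of their common values at (x, k) as k decreases to 0. *)
Lemma extension_on_domain u g : {within Omega, continuous u} ->
  {within K, continuous g} ->
  (forall p, Omega p -> 0 < p.2 -> p.2 <= T -> g p = u p) ->
  forall p, W p -> g p = u p.
Proof.
move=> /subspace_continuousP cu /subspace_continuousP cg gu p Wp.
have [Op pT] := Wp; have := domain_ge0 p Op; rewrite le_eqVlt.
move=> /orP[/eqP/esym p0|p_gt0]; last exact: gu.
have ug : u (k *: dir None + p) @[k --> (0 : R)^'+] --> u p.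
  apply: cvg_comp (shift_time_cvg_in p Omega Op p0 _) (cu p Op).
  by move=> q [].
have gg : g (k *: dir None + p) @[k --> (0 : R)^'+] --> g p.
  apply: cvg_comp (shift_time_cvg_in p K Op p0 _) (cg p _).
    exact: subset_closure.
  exact: subset_closure.
apply: (cvg_unique _ gg); first exact: Rhausdorff.
apply: cvg_trans ug; apply: near_eq_cvg; near=> k.
have [? ? ?] : [/\ Omega (k *: dir None + p),
    0 < (k *: dir None + p).2 & (k *: dir None + p).2 <= T].
  by near: k; exact: shift_time_in.
exact/esym/gu.
Unshelve. all: by end_near. Qed.

Lemma extension_off_domain u g : {within K, continuous g} ->
  (forall p, W p -> g p = u p) ->
  (forall p, closure Omega p -> ~ Omega p ->
      u @ within Omega (nbhs p) --> (0 : R)) ->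
  forall p, K p -> ~ Omega p -> g p = 0.
Proof.
move=> /subspace_continuousP cg gu u0 p Kp Op.
have FF : ProperFilter (within W (nbhs p)) by exact: within_nbhs_proper.
have WO : W `<=` Omega by move=> q [].
have gg : g @ within W (nbhs p) --> g p.
  move=> A /(cg p Kp) NA; change (\forall q \near p, W q -> A (g q)).
  have {}NA : \forall q \near p, K q -> A (g q) := NA.
  by apply: filterS NA => q H Wq; apply: H; exact: subset_closure.
apply: (cvg_unique _ gg); first exact: Rhausdorff.
have ug : u @ within W (nbhs p) --> (0 : R).
  move=> A /(u0 p (closure_subset WO Kp) Op) NA.
  change (\forall q \near p, W q -> A (u q)).
  have {}NA : \forall q \near p, Omega q -> A (u q) := NA.
  by apply: filterS NA => q H Wq; apply: H; exact: WO.
apply: cvg_trans ug; apply: near_eq_cvg.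
change (\forall q \near p, W q -> u q = g q).
by apply: filterE => q Wq; exact/esym/gu.
Qed.

(** At t = 0 the derivative of u is only known to exist, while [g] is a limit of derivatives from t
    > 0. The two are compared by the mean value theorem on the nearby slices t = k > 0: first k
    tends to 0, then the spatial step h. *)
Lemma initial_derivative u g i : {within Omega, continuous u} ->
  (forall p, Omega p -> derivable u p (dir (Some i))) ->
  {within K, continuous g} ->
  (forall p, Omega p -> 0 < p.2 -> p.2 <= T -> g p = du u i p) ->
  forall p, W p -> g p = du u i p.
Proof.
move=> /subspace_continuousP cu ud /subspace_continuousP cg gu p Wp.
have [Op pT] := Wp; have := domain_ge0 p Op; rewrite le_eqVlt.
move=> /orP[/eqP/esym p0|p_gt0]; last exact: gu.
apply/eqP; rewrite -subr_eq0 -normr_le0; apply/ler_addgt0Pl => e e0; rewrite addr0.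
have KW : W `<=` K := @subset_closure _ W.
have /cvgrPdist_le/(_ e e0) cge := cg p (KW _ Wp).
have [d d0 dP] :=
  near_plane _ _ (dir (Some i)) (dir None) (filterI (near_domain p Op) cge).
have q2 (s k : R) : (s *: dir (Some i) + (k *: dir None + p) : pt R n).2 = k.
  by rewrite /= p0 addr0 scaler0 add0r -[_ *: _]/(_ * _) mulr1.
have quot h : `|h| < d ->
    `|u (h *: dir (Some i) + p) - u p - h * g p| <= `|h| * e.
  move=> hd.
  have Oh : Omega (h *: dir (Some i) + p).
    have d0' : `|0 : R| < d by rewrite normr0.
    have [+ _] := dP _ _ hd d0'; rewrite q2 scale0r add0r; exact.
  have h2 : (h *: dir (Some i) + p).2 = 0.
    by have := q2 h 0; rewrite scale0r add0r.
  have c1 q : Omega q -> q.2 = 0 ->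
      u (k *: dir None + q) @[k --> (0 : R)^'+] --> u q.
    move=> Oq q0; apply: cvg_comp (shift_time_cvg_in q Omega Oq q0 _) (cu q Oq).
    by move=> r [].
  have L : `|u (k *: dir None + (h *: dir (Some i) + p)) - u (k *: dir None + p)
      - h * g p| @[k --> (0 : R)^'+]
      --> `|u (h *: dir (Some i) + p) - u p - h * g p|.
    apply: cvg_norm; apply: cvgB; last exact: cvg_cst.
    by apply: cvgB; exact: c1.
  (* It suffices to prove the bound at times k > 0, where u has derivative [g] along the whole
     segment. *)
  apply: (closed_cvg (fun x : R => x <= `|h| * e) _ _ _ L).
    exact: closed_le.
  near=> k.
  have k0 : 0 < k by [].
  have kd : `|k| < d by rewrite gtr0_norm.
  have kT : k <= T by rewrite ltW.
  have sO s : 0 <= s <= 1 ->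
      let q := (s * h) *: dir (Some i) + (k *: dir None + p) in
      W q /\ `|g p - g q| <= e.
    move=> /andP[s0 s1].
    have sd : `|s * h| < d.
      by rewrite normrM (ger0_norm s0) (le_lt_trans _ hd)// ler_piMl.
    have [H1 H2] := dP _ _ sd kd.
    have Wq : W ((s * h) *: dir (Some i) + (k *: dir None + p)).
      by split; [apply: H1; rewrite q2 ltW|rewrite q2].
    by split=> //; apply: H2; exact: KW.
  have [s s01|s /andP[s0 s1] E] :=
      @MVT_line _ _ u (k *: dir None + p) (dir (Some i)) h.
    by have [[H _] _] := sO s s01; exact: ud.
  have [[Oq qT] ge] := sO s (introT andP (conj (ltW s0) (ltW s1))).
  have gE : g ((s * h) *: dir (Some i) + (k *: dir None + p)) =
      'D_(dir (Some i)) u ((s * h) *: dir (Some i) + (k *: dir None + p)).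
    by apply: gu => //; rewrite q2.
  rewrite (addrCA (k *: dir None)) E -gE.
  by rewrite -mulrBr normrM distrC ler_wpM2l.
have dd := ud p Op; rewrite distrC.
have L : (fun h => `|h^-1 *: ((u \o shift p) (h *: dir (Some i)) - u p) - g p|)
     h @[h --> 0^'] --> `|du u i p - g p|.
  by apply: cvg_norm; apply: cvgB; [exact: dd|exact: cvg_cst].
apply: (closed_cvg (fun x : R => x <= e) _ _ _ L); first exact: closed_le.
near=> h.
have h0 : h != 0 by near: h; exact: nbhs_dnbhs_neq.
have hd : `|h| < d by near: h; exact: dnbhs0_lt.
rewrite -(ler_pM2l (_ : 0 < `|h|)) ?normr_gt0// -normrM mulrBr.
by rewrite -[h^-1 *: _]/(_ * _) mulVKf//; exact: quot.
Unshelve. all: by end_near. Qed.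

(** The slab lies in the product of a closed ball with [0, T], which is compact. *)
Lemma compact_slab :
  (exists M : R, forall p, Omega p -> p.2 <= T -> `|p.1| <= M) -> compact K.
Proof.
move=> [M HM].
pose B := [set v : 'rV[R]_n.+1 | `|v| <= M].
have clB : closed B.
  have := @closed_closed_ball_ _ 'rV[R]_n.+1 0 M; congr closed.
  by apply/seteqP; split => v; rewrite /B /closed_ball_ /= sub0r normrN.
have cB : compact B.
  apply: bounded_closed_compact clB.
  by exists M; split; [exact: num_real|move=> x Mx v /= vM; rewrite (le_trans vM)// ltW].
have cBT : compact (B `*` `[0, T]%classic).
  by apply: compact_setX => //; exact: segment_compact.
apply: (subclosed_compact _ cBT); first exact: closed_closure.
have clBT : closed (B `*` `[0, T]%classic).
  apply: compact_closed cBT; exact: norm_hausdorff.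
rewrite [X in _ `<=` X]((closure_id _).1 clBT); apply: closure_subset => p [Op pT].
by split; [exact: HM|rewrite /= in_itv /= pT domain_ge0].
Qed.

End SpaceTimeDomain.

(** * The penalised maximum principle on the slab *)

Section MaximumPrinciple.
Context {R : realType} {n : nat} {Omega : set (pt R n)} {u : pt R n -> R}.
Hypothesis hyp : standing_assumption Omega u.
Variable T : R.
Hypothesis T0 : 0 < T.
Implicit Types (p q z : pt R n) (Phi : pt R n -> R).

Let W := [set p | Omega p /\ p.2 <= T].
Let K := closure W.
Let G := [set p | Omega p /\ 0 < p.2].

Let domain_open :
  exists O : set (pt R n), open O /\ Omega = O `&` [set p | 0 <= p.2].
Proof. by have [] := hyp. Qed.

Let openG : open G.
Proof.
have [A [oA OmE]] := domain_open.
have -> : G = A `&` [set p | 0 < p.2].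
  rewrite /G OmE; apply/seteqP; split => q /=; first by move=> [[]].
  by move=> [Aq q0]; do !split => //; exact: ltW.
apply: openI => //.
apply: (@open_comp _ _ (fun p : pt R n => p.2) [set t | 0 < t]).
  by move=> q _; exact: cvg_snd.
exact: open_gt.
Qed.

Let smoothG a p : G p ->
  {for p, continuous (Dmulti a u)} /\ forall d, derivable (Dmulti a u) p (dir d).
Proof. by have [_ [sm _]] := hyp; move=> [Op p0]; exact: sm. Qed.

Let flowG p : G p -> dt u p = mcf_rhs u p.
Proof. by have [_ [_ [_ [fl _]]]] := hyp; move=> [Op p0]; exact: fl. Qed.

Lemma slab_time q : K q -> 0 <= q.2 <= T.
Proof.
move=> Kq; have FF : ProperFilter (within W (nbhs q)) by exact: within_nbhs_proper.
have L : p.2 @[p --> within W (nbhs q)] --> q.2.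
  by apply: cvg_within_filter; exact: cvg_snd.
have H : \forall p \near q, W p -> 0 <= p.2 <= T.
  by apply: filterE => p [Op ->]; rewrite andbT (domain_ge0 Omega domain_open).
apply/andP; split.
  apply: (closed_cvg (fun x : R => 0 <= x) _ _ _ L); first exact: closed_ge.
  change (\forall p \near q, W p -> 0 <= p.2).
  by apply: filterS H => p H /H /andP[].
apply: (closed_cvg (fun x : R => x <= T) _ _ _ L); first exact: closed_le.
change (\forall p \near q, W p -> p.2 <= T).
by apply: filterS H => p H /H /andP[].
Qed.

Lemma lyapE q : lyap u q = (vgrad u q * u q ^+ 2) ^+ 2.
Proof. by rewrite exprMn vgrad_sq -exprM. Qed.

(** A continuous substitute for psi on the compact closure, built from the extensions of u and Du
    and zero where u >= 0. Since u tends to 0 at boundary points outside [Omega], a point with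
    positive value lies in the domain and has u < 0. *)
Lemma slab_extension : exists Phi, [/\ {within K, continuous Phi},
  (forall q, W q -> u q < 0 -> Phi q = lyap u q) &
  (forall q, K q -> 0 < Phi q -> W q /\ u q < 0)].
Proof.
have [_ [_ [[cu ud] [_ [bd /(_ T T0)[_ ext]]]]]] := hyp.
have [_ [g0 [cg0 g0u]]] := ext [::].
have g0E q : W q -> g0 q = u q by exact: (extension_on_domain Omega T T0).
have g0off q : K q -> ~ Omega q -> g0 q = 0.
  exact: (extension_off_domain Omega T u).
have /choice[g gP] : forall i : 'I_n.+1, exists g : pt R n -> R,
    {within K, continuous g} /\ forall q, W q -> g q = du u i q.
  move=> i; have [_ [g [cg gu]]] := ext [:: Some i]; exists g; split=> //.
  apply: (initial_derivative Omega T T0 domain_open u) => //.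
  by move=> q Oq; exact: ud.
(* w is the negative part min(g0, 0). *)
pose w q := (g0 q - `|g0 q|) / 2.
exists (fun q => (1 + \sum_i g i q ^+ 2) * w q ^+ 4); split.
- apply/subspace_continuousP => q Kq.
  have pw (f : pt R n -> R) k : f @ within K (nbhs q) --> f q ->
      f x ^+ k @[x --> within K (nbhs q)] --> f q ^+ k.
    move=> fq.
    have ck : {for f q, continuous (fun y : R => y ^+ k)}.
      exact: exprn_continuous.
    exact: continuous_cvg ck fq.
  have g0q : g0 @ within K (nbhs q) --> g0 q by move/subspace_continuousP: cg0; apply.
  apply: cvgM.
    apply: cvgD; first exact: cvg_cst.
    apply: cvg_big => [|i _]; first exact: add_continuous.
    by apply: pw; have [/subspace_continuousP cg _] := gP i; exact: cg.
  apply: pw; rewrite /w; apply: cvgM; last exact: cvg_cst.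
  by apply: cvgB => //; exact: cvg_norm.
- move=> q Wq u0; rewrite /lyap /w g0E// ltr0_norm// opprK.
  rewrite (_ : (u q + u q) / 2 = u q); last by field.
  congr (_ * _); rewrite /grad_sq; congr (_ + _).
  by apply: eq_bigr => i _; have [_ ->] := gP i.
- move=> q Kq; rewrite /w; have [g00|g00] := leP 0 (g0 q).
    by rewrite ger0_norm// subrr mul0r expr0n mulr0 ltxx.
  move=> _; have Oq : Omega q.
    by apply: contrapT => /(g0off _ Kq) E; rewrite E ltxx in g00.
  have Wq : W q by split=> //; have /andP[] := slab_time q Kq.
  by split=> //; rewrite -g0E.
Qed.

(** At a positive time the penalised maximum would be a spatial maximum of psi with psi_t >= eps,
    which [lyap_no_interior_max] excludes. *)
Lemma slab_max_at_initial_time Phi (eps : R) z :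
  (forall q, W q -> u q < 0 -> Phi q = lyap u q) ->
  (forall q, K q -> 0 < Phi q -> W q /\ u q < 0) ->
  0 < eps -> K z -> 0 < Phi z ->
  (forall q, K q -> Phi q - eps * q.2 <= Phi z - eps * z.2) ->
  z.2 = 0.
Proof.
move=> PhiE Phi_gt0 eps0 Kz Pz zmax.
have [Wz uz] := Phi_gt0 z Kz Pz; have [Oz zT] := Wz.
have := domain_ge0 Omega domain_open z Oz.
rewrite le_eqVlt => /orP[/eqP//|z0]; exfalso.
have Gz : G z by split.
have nz : \forall q \near z, G q /\ u q < 0.
  apply: filterI; first by exact: open_nbhs_nbhs.
  have [cu _] := smoothG [::] z Gz.
  by have /cvgr_lt := cu; apply.
have lyap_le w : \forall h \near (0 : R),
    (h *: w + z).2 <= T ->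
    lyap u (h *: w + z) - eps * (h *: w + z).2 <= lyap u z - eps * z.2.
  apply: filterS (near_line _ _ w nz) => h [[Oh _] uh] hT.
  have Wh : W (h *: w + z) by [].
  rewrite -(PhiE _ Wh uh) -(PhiE _ Wz uz); apply: zmax; exact: subset_closure.
apply: (lyap_no_interior_max u G openG smoothG flowG z Gz).
- by rewrite lt_eqF.
- move=> w w2; apply: filterS (lyap_le w) => h.
  have -> : (h *: w + z).2 = z.2 by rewrite /= w2 scaler0 add0r.
  by move=> /(_ zT); rewrite lerD2r.
- have [D DE] := is_derive_lyap u G smoothG None z Gz.
  apply: (lt_le_trans eps0); rewrite -DE.
  (* Only backward time differences are used, as z may lie on the top slice t = T. *)
  apply: (closed_cvg (fun x : R => eps <= x) _ _ _ (cvg_dnbhs_at_left D)).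
    exact: closed_ge.
  have hle : \forall h \near (0 : R)^'-, (h *: dir None + z : pt R n).2 <= T ->
      lyap u (h *: dir None + z) - eps * (h *: dir None + z : pt R n).2
      <= lyap u z - eps * z.2.
    exact: (cvg_at_left_filter (cvg_id (F := nbhs (0 : R)))) (lyap_le (dir None)).
  have neg : \forall h \near (0 : R)^'-, h < 0 by near=> h.
  apply: filterS2 hle neg => h H h0.
  have z2 : (h *: dir None + z : pt R n).2 = h + z.2.
    by rewrite /= -[_ *: _]/(_ * _) mulr1.
  have hT : h + z.2 <= T by rewrite (le_trans _ zT)// gerDr ltW.
  move: H; rewrite z2 => /(_ hT) H.
  rewrite -[_ *: _]/(_ * _) mulrC ler_ndivlMr//=.
  have aux (a b : R) : a - eps * (h + z.2) <= b - eps * z.2 -> a - b <= eps * h.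
    by lra.
  exact: aux H.
Unshelve. all: by end_near. Qed.

End MaximumPrinciple.

(** * Removal of the penalty and the maximum over the initial slice *)

Theorem theorem5p3 (R : realType) (n : nat) (Omega : set (pt R n))
  (u : pt R n -> R) :
  standing_assumption Omega u ->
  forall p : pt R n, Omega p -> u p < 0 ->
  exists y0 : 'rV[R]_(n.+1),
    [/\ Omega (y0, 0), u (y0, 0) < 0,
        (forall y : 'rV[R]_(n.+1), Omega (y, 0) -> u (y, 0) < 0 ->
           vgrad u (y, 0) * u (y, 0) ^+ 2 <= vgrad u (y0, 0) * u (y0, 0) ^+ 2) &
        vgrad u p * u p ^+ 2 <= vgrad u (y0, 0) * u (y0, 0) ^+ 2].
Proof.
move=> hyp p Op up.
have [dom [_ [_ [_ [_ bounds]]]]] := hyp.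
have p0 : 0 <= p.2 := domain_ge0 Omega dom p Op.
(* The added 1 keeps [T] positive when p itself is an initial point. *)
pose T := p.2 + 1; have T0 : 0 < T by rewrite ltr_wpDl.
pose W := [set q | Omega q /\ q.2 <= T]; pose K := closure W.
have [Phi [/[dup] cPhi /subspace_continuousP cPhi' PhiE Phi_gt0]] :=
  slab_extension hyp T T0.
have WK : W `<=` K by exact: subset_closure.
have Wp : W p by split=> //; rewrite lerDl.
have cK : compact K := compact_slab Omega T dom (bounds T T0).1.
have lyap_gt0 q : u q < 0 -> 0 < lyap u q.
  by move=> uq; rewrite mulr_gt0 ?grad_sq_gt0// exprn_even_gt0//= lt_eqF.
have Pp : 0 < Phi p by rewrite PhiE// lyap_gt0.
(* The smallness of [eps] makes the penalised value at p positive, hence also the maximum, so that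
   [slab_max_at_initial_time] applies. *)
have approx (eps : R) : 0 < eps -> eps * p.2 < Phi p ->
    exists z, [/\ K z, z.2 = 0 & Phi p - eps * p.2 <= Phi z].
  move=> eps0 small.
  have [||z] := @compact_EVT_max _ _ (fun q => Phi q - eps * q.2) K _ cK.
  - by exists p; exact: WK.
  - apply/subspace_continuousP => q Kq; apply: cvgB; first exact: cPhi'.
    apply: cvgM; first exact: cvg_cst.
    by apply: cvg_within_filter; exact: cvg_snd.
  move=> /set_mem Kz zmax.
  have {}zmax q : K q -> Phi q - eps * q.2 <= Phi z - eps * z.2.
    by move=> Kq; apply: zmax; exact/mem_set.
  have /andP[z0 _] := slab_time hyp T z Kz.
  have Pz : 0 < Phi z.
    have : 0 < Phi z - eps * z.2.
      by apply: lt_le_trans (zmax p (WK _ Wp)); rewrite subr_gt0.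
    by rewrite subr_gt0; apply: le_lt_trans; rewrite mulr_ge0// ltW.
  have zt := slab_max_at_initial_time hyp T Phi eps z PhiE Phi_gt0 eps0 Kz Pz zmax.
  exists z; split=> //.
  by have := zmax p (WK _ Wp); rewrite zt mulr0 subr0.
(* The initial slice of the closure is compact, unlike the set of initial points with u < 0; its
   maximiser is placed in the latter set afterwards, by positivity of [Phi]. *)
pose K0 := K `&` [set q | q.2 = 0].
have cK0 : compact K0.
  apply: (subclosed_compact _ cK); last by move=> q [].
  apply: closedI; first exact: closed_closure.
  apply: (@closed_comp _ _ (fun p : pt R n => p.2) [set 0 : R]).
    by move=> q _; exact: cvg_snd.
  exact: closed_eq.
have [y yK0 ymax] : exists2 y, K0 y & forall q, K0 q -> Phi q <= Phi y.
  have [||y yK0 ymax] := @compact_EVT_max _ _ Phi K0 _ cK0.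
  - have [||z [Kz z0 _]] := approx (Phi p / (p.2 + 1)).
    + by rewrite divr_gt0.
    + by rewrite mulrAC ltr_pdivrMr// ltr_pM2l// ltrDl.
    by exists z.
  - by apply: continuous_subspaceW cPhi => q [].
  exists y; first exact: set_mem.
  by move=> q Kq; apply: ymax; exact/mem_set.
have le_y : Phi p <= Phi y.
  apply/ler_addgt0Pl => e e0.
  (* The penalty [m] must cost at most [e] at p and still satisfy the smallness condition of
     [approx]. *)
  have [m [m0 me mp]] : exists m : R, [/\ 0 < m, m * p.2 <= e & m * p.2 < Phi p].
    pose c := Num.min e (Phi p); have c0 : 0 < c by rewrite lt_min e0.
    have H : c / (p.2 + 1) * p.2 < c.
      by rewrite mulrAC ltr_pdivrMr// ltr_pM2l// ltrDl.
    exists (c / (p.2 + 1)); split; first by rewrite divr_gt0.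
      by rewrite ltW// (lt_le_trans H)// ge_min lexx.
    by rewrite (lt_le_trans H)// ge_min lexx orbT.
  have [z [Kz z0 Hz]] := approx m m0 mp.
  have := ymax z (conj Kz z0); lra.
have [Ky y0] := yK0; have Py : 0 < Phi y := lt_le_trans Pp le_y.
have [Wy uy] := Phi_gt0 y Ky Py; have [Oy _] := Wy.
(* Passage from psi = (v u^2)^2 back to v u^2, which is nonnegative. *)
have lyap_le q : u q < 0 -> W q -> Phi q <= Phi y ->
    vgrad u q * u q ^+ 2 <= vgrad u y * u y ^+ 2.
  move=> uq Wq; rewrite !PhiE// !lyapE ler_sqr ?nnegrE//.
    by rewrite mulr_ge0 ?sqr_ge0// ltW// vgrad_gt0.
  by rewrite mulr_ge0 ?sqr_ge0// ltW// vgrad_gt0.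
have yE : y = (y.1, 0) by rewrite [LHS]surjective_pairing y0.
exists y.1; rewrite -yE; split => //; last exact: lyap_le.
move=> x Ox ux; have Wx : W (x, 0) by split=> //; exact: ltW.
by apply: lyap_le => //; apply: ymax; split=> //; exact: WK.
Qed.
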